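(* Consider the extended bottleneck model with charging of plug-in electric vehicles described in the context, with no limit on the monetary budget. Then the optimal energy price discount (in the sense of the context) is, for $t\in[0,N/s]$, $$p^*(t)=\alpha-\frac{g(t)}{\bar\delta}+\sqrt{\left(\frac{g(t)}{\bar\delta}-\alpha\right)^2-\alpha^2},\qquad g(t):=\begin{cases}\beta(t-t^* ), & t<t^*,\\ \gamma(t^*-t), & \text{otherwise.}\end{cases}$$ The total system travel time is $\Gamma=0$, and the required monetary budget is $$M_\$^*=\frac{\beta\gamma N^2}{2s(\beta+\gamma)}+s\int_0^{N/s}\frac{p^*(\tau)^2-\alpha^2}{2p^*(\tau)}\,d\tau .$$
   Context: Bottleneck model. $N$ homogeneous commuters (treated as a continuum of total mass $N$) enter a single bottleneck of constant capacity $s>0$ during the period $[0,N/s]$ with departure rate $r(t)\ge 0$, $\int_0^{N/s}r(t)\,dt=N$. The queue is $Q(t)=\int_{\hat t}^t r(\tau)\,d\tau-s(t-\hat t)$, where $\hat t<t$ is the last moment with $Q(\hat t)=0$ (initially there is no queue); vehicles leave first-in-first-out, and a commuter entering at time $t$ waits $T^{\mathrm v}(t)=Q(t)/s$. Fixed (congestion-free) travel times are taken to be $0$, so a commuter entering at $t$ reaches the destination at $t+T^{\mathrm v}(t)$. All commuters have the same desired arrival time $t^*$; the time origin is such that $t^*=\frac{\gamma N}{s(\beta+\gamma)}$. The unit costs of travel/waiting time, early arrival and late arrival are $\alpha,\beta,\gamma>0$, with $\beta<\alpha<\gamma$. The travel cost of entering at $t$ is $$\hat C(t)=\alpha T^{\mathrm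 v}(t)+\max\big(\beta d(t),-\gamma d(t)\big),\qquad d(t)=t^*-t-T^{\mathrm v}(t).$$ Charging. Each vehicle must charge for a total of $\bar\delta>0$ time units before entering the bottleneck. A commuter entering the bottleneck at $t$ charges for $\delta\in[0,\bar\delta]$ time units at a charging station during $[t-\delta,t]$, where the price is discounted by $p(t)\ge 0$ from the fixed price $\bar p$ (the discount depends on the time $t$ of entering the bottleneck), and for the remaining $\bar\delta-\delta$ at home at price $\bar p$. The discount perceived at time $\tau\in[t-\delta,t]$ is $\hat p(\tau,t)=-\frac{p(t)}{\bar\delta}\tau+\frac{p(t)}{\bar\delta}(t-\delta+\bar\delta)$. The charging cost is $$C_{\mathrm{ch}}(t,\delta)=\alpha\delta+(\bar\delta-\delta)\bar p+\int_{t-\delta}^t\big(\bar p-\hat p(\tau,t)\big)\,d\tau,$$ minimised over $\delta\in[0,\bar\delta]$ by $\delta^*(t)=\max\{(1-\alpha/p(t))\bar\delta,\,0\}$ (equal to $0$ if $p(t)=0$). With $\delta=\delta^*(t)$ it is $C_{\mathrm{ch}}(t)=-\frac{\bar\delta}{2p(t)}(p(t)-\alpha)^2+\bar\delta\bar p$ if $p(t)\ge\alpha$, and $C_{\mathrm{ch}}(t)=\bar\delta\bar p$ otherwise. Commuters use $\delta^*$, so the total cost of entering at $t$ is $C(t)=\hat C(t)+C_{\mathrm{ch}}(t)$. Equilibrium. Commuters are rational and choose $t$ to minimise $C(t)$. Given a discount $p$, the departure rate $r$ is at equilibrium when all commuters experience the same total cost, i.e. $C(t)=C_e$ for all $t\in[0,N/s]$,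 for a constant $C_e$. Optimality. The total system travel time is $\Gamma=\int_0^{N/s}T^{\mathrm v}(t)\,dt$, and the monetary budget used by a discount $p$ is $M_\$=\int_0^{N/s}r(\tau)\,\delta^*(\tau)\,p(\tau)\,d\tau$, both evaluated at equilibrium. A discount policy $p(t)$ is optimal if it minimises $\Gamma$ while using the smallest budget $M_\$$.
   Formalization: The second term of the budget carries the factor δ̄ (s·δ̄·∫ instead of s·∫), since the printed formula is false unless δ̄=1; and the optimal discount is shown unique on [0,N/s] except at t=t*, where any value in [0,α] is equally optimal. *)

(* Defs.v *)
From HB Require Import structures.
From mathcomp Require Import all_boot all_order all_algebra.
From mathcomp Require Import all_classical all_reals all_analysis.

Set Implicit Arguments.
Unset Strict Implicit.
Unset Printing Implicit Defensive.

Import Order.TTheory GRing.Theory Num.Theory.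
Import numFieldNormedType.Exports.

Local Open Scope classical_set_scope.
Local Open Scope ring_scope.

(* [alpha], [beta], [gamma] are the unit costs of waiting (or charging) time,
   early arrival and late arrival; [dbar] is the required charging time and
   [pbar] the undiscounted energy price. *)
Record bottleneck (R : realType) := Bottleneck {
  mass : R;
  capacity : R;
  alpha : R;
  beta : R;
  gamma : R;
  dbar : R;
  pbar : R
}.

Section Model.
Context {R : realType}.
Variable m : bottleneck R.

Local Notation mu := (@lebesgue_measure R).
Local Notation s := (capacity m).

Definition horizon : R := mass m / s.

Definition period : set R := `[0, horizon].

Definition tstar : R := gamma m * mass m / (s * (beta m + gamma m)).

Definition departure_rate (r : R -> R) : Prop :=
  [/\ measurable_fun period r,
      forall t, period t -> 0 <= r t &
      (\int[mu]_(t in period) (r t)%:E = (mass m)%:E)%E].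

Definition last_empty (Q : R -> R) (t that : R) : Prop :=
  [/\ 0 <= that < t, Q that = 0 & forall u, that < u < t -> Q u <> 0].

(* [Q] is the queue generated by [r].  The last moment before [t] without a
   queue exists when there is a queue at [t], but it need not exist otherwise
   (e.g. when [Q] vanishes on an interval ending at [t]), and the formula for
   [Q t] is then void.  The last clause covers this case: it says that at most
   [s * (t - u)] vehicles leave the bottleneck during [u, t].  Without it, the
   zero function would be a queue for every [r]. *)
Definition is_queue (r Q : R -> R) : Prop :=
  [/\ Q 0 = 0,
      forall t, period t -> 0 <= Q t,
      forall t, period t -> 0 < Q t -> exists that, last_empty Q t that,
      forall t that, period t -> last_empty Q t that ->
        Q t = \int[mu]_(tau in `[that, t]) r tau - s * (t - that) &
      forall u t : R, 0 <= u -> u <= t -> t <= horizon ->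
        \int[mu]_(tau in `[u, t]) r tau - (Q t - Q u) <= s * (t - u)].

Definition waiting_time (Q : R -> R) (t : R) : R := Q t / s.

Definition earliness (Q : R -> R) (t : R) : R :=
  tstar - t - waiting_time Q t.

Definition travel_cost (Q : R -> R) (t : R) : R :=
  alpha m * waiting_time Q t
  + Num.max (beta m * earliness Q t) (- gamma m * earliness Q t).

Definition discount_policy (p : R -> R) : Prop :=
  measurable_fun period p /\ forall t, period t -> 0 <= p t.

Definition perceived_discount (p : R -> R) (delta tau t : R) : R :=
  - (p t / dbar m) * tau + p t / dbar m * (t - delta + dbar m).

Definition charging_cost (p : R -> R) (t delta : R) : R :=
  alpha m * delta + (dbar m - delta) * pbar m
  + \int[mu]_(tau in `[t - delta, t])
      (pbar m - perceived_discount p delta tau t).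

(* The minimiser of [charging_cost p t] on [0, dbar]; the value at [p t = 0]
   is set apart because [alpha / 0] is [0] here. *)
Definition delta_star (p : R -> R) (t : R) : R :=
  if p t == 0 then 0 else Num.max ((1 - alpha m / p t) * dbar m) 0.

Definition total_cost (p Q : R -> R) (t : R) : R :=
  travel_cost Q t + charging_cost p t (delta_star p t).

Definition equilibrium (p r Q : R -> R) : Prop :=
  [/\ departure_rate r, is_queue r Q &
      exists Ce : R, forall t, period t -> total_cost p Q t = Ce].

Definition total_travel_time (Q : R -> R) : \bar R :=
  (\int[mu]_(t in period) (waiting_time Q t)%:E)%E.

Definition budget (p r : R -> R) : \bar R :=
  (\int[mu]_(tau in period) (r tau * delta_star p tau * p tau)%:E)%E.

(* A discount need not determine its equilibrium departure rate, so an optimal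
   discount is compared with the others at each of its equilibria (of which at
   least one must exist). *)
Definition optimal (p : R -> R) : Prop :=
  [/\ discount_policy p,
      exists r Q, equilibrium p r Q &
      forall r Q, equilibrium p r Q ->
      forall p' r' Q', discount_policy p' -> equilibrium p' r' Q' ->
        (total_travel_time Q <= total_travel_time Q')%E /\
        (total_travel_time Q' = total_travel_time Q ->
         (budget p r <= budget p' r')%E)].

Definition g (t : R) : R :=
  if t < tstar then beta m * (t - tstar) else gamma m * (tstar - t).

Definition pstar (t : R) : R :=
  alpha m - g t / dbar m
  + Num.sqrt ((g t / dbar m - alpha m) ^+ 2 - alpha m ^+ 2).

End Model.

(* Main.v *)
(* At an equilibrium the travel cost less the saving on charging is constant.
   Since beta < alpha, the travel cost increases strictly with the queue, and
   without a queue it is - g; the discount pstar is the one whose saving is - g,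
   so it leaves no queue.  Conversely, if some equilibrium has zero total travel
   time then its queue vanishes, its departure rate is s almost everywhere (by
   Lebesgue differentiation), and its saving is - g + c with c >= 0, because a
   saving is nonnegative at tstar.  The saving grows at most half as fast as
   dbar times the discount, so that c > 0 makes the budget exceed that of pstar
   by at least 2 c N.  Hence c = 0, which determines the discount wherever the
   saving is positive, i.e. away from tstar. *)
Require Import Defs.
From HB Require Import structures.
From mathcomp Require Import all_boot all_order all_algebra.
From mathcomp Require Import all_classical all_reals all_analysis.
From mathcomp Require Import measurable_realfun ring lra.

Set Implicit Arguments.
Unset Strict Implicit.
Unset Printing Implicit Defensive.

Import Order.TTheory GRing.Theory Num.Theory.
Import numFieldNormedType.Exports.

Local Open Scope classical_set_scope.
Local Open Scope ring_scope.

(** * Integration on intervals and Lebesgue differentiation *)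

Lemma Rintegral_affine (R : realType) (a b c e : R) : a <= b ->
  \int[@lebesgue_measure R]_(x in `[a, b]) (c * x + e) =
    c / 2 * (b ^+ 2 - a ^+ 2) + e * (b - a).
Proof.
rewrite le_eqVlt => /predU1P[->|ab].
  by rewrite set_itv1 Rintegral_set1 !subrr !mulr0 addr0.
pose F x := c / 2 * x ^+ 2 + e * x : R.
have dF (x : R) : is_derive x 1 F (c * x + e).
  by apply: is_derive_eq; rewrite /GRing.scale/=; field.
have cF : continuous F.
  by move=> x; apply: differentiable_continuous; apply/derivable1_diffP; apply: ex_derive.
rewrite /Rintegral (@continuous_FTC2 _ _ F)//.
- by rewrite -EFinB/= /F; ring.
- apply: continuous_subspaceT => x.
  by apply: cvgD; [apply: cvgM; [exact: cvg_cst|exact: cvg_id]|exact: cvg_cst].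
- split.
  + by move=> x _; apply: ex_derive.
  + exact/cvg_at_right_filter/cF.
  + exact/cvg_at_left_filter/cF.
- by move=> x _; rewrite derive1E derive_val.
Qed.

(* Unlike in [ge0_le_integral], neither function needs to be measurable. *)
Lemma ge0_integral_mono (d : measure_display) (T : measurableType d)
    (R : realType) (mu : {measure set T -> \bar R}) (D : set T)
    (f1 f2 : T -> \bar R) :
  (forall x, D x -> (0 <= f1 x)%E) -> (forall x, D x -> (f1 x <= f2 x)%E) ->
  (\int[mu]_(x in D) f1 x <= \int[mu]_(x in D) f2 x)%E.
Proof.
move=> f1_ge0 f12.
have f2_ge0 x : D x -> (0 <= f2 x)%E.
  by move=> Dx; exact: le_trans (f1_ge0 x Dx) (f12 x Dx).
rewrite integral_mkcond [leRHS]integral_mkcond.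
rewrite !ge0_integralTE; try exact: erestrict_ge0.
apply: ereal_sup_le => _ [h hf1 <-]; exists h => // x.
apply: le_trans (hf1 x) _; rewrite !patchE.
by case: ifPn => // /set_mem; exact: f12.
Qed.

(** The primitive of [r] agrees with [k * x] near every interior point, so its derivative there is
    [k]; by Lebesgue differentiation this derivative is [r] almost everywhere. *)
Lemma ae_eq_cst_of_primitive (R : realType) (r : R -> R) (k b : R) :
  (@lebesgue_measure R).-integrable `[0, b] (EFin \o r) ->
  (forall x, 0 < x < b -> \int[@lebesgue_measure R]_(y in `[0, x]) r y = k * x) ->
  {ae @lebesgue_measure R, forall x, x \in `]0, b[ -> r x = k}.
Proof.
(* Extension by zero gives integrability on [[0, y]] for every [y], also beyond [b], as [FTC1]
   asks. *)
move=> ir rE; pose f := r \_ `[0, b].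
have if_ : (@lebesgue_measure R).-integrable setT (EFin \o f).
  by move/integrable_mkcond : ir; rewrite restrict_EFin; exact.
have intf y : (@lebesgue_measure R).-integrable
    [set` Interval (BLeft 0) (BRight y)] (EFin \o f).
  by apply: integrableS if_.
have mb : measurable (`[0, b] : set R) by exact: measurable_itv.
have := FTC1 intf (integrable_locally_restrict mb ir).
apply: filterS; first exact: (ae_filter_ringOfSetsType lebesgue_measure).
move=> x /= dF; rewrite in_itv/= =>  /andP[x0 xb].
have [|_] := dF; first by rewrite lte_fin.
rewrite {2}/f patchE mem_set/= ?in_itv/= ?(ltW x0) ?(ltW xb)// => <-.
rewrite derive1E.
transitivity ('D_1 (fun x : R => k * x) x); last first.
  rewrite (_ : (fun y : R => k * y) = (k *: @id R)); last by [].
  by rewrite deriveZ//= derive_id scaler1.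
apply: near_eq_derive.
have : x \in `]0, b[ by rewrite in_itv/= x0.
move/near_in_itvoo; apply: filterS => y; rewrite in_itv/= => /andP[y0 yb].
rewrite -rE ?y0//; apply: eq_Rintegral => z.
rewrite inE/= in_itv/= => /andP[z0 zy].
by rewrite /f patchE mem_set//= in_itv/= z0 (le_trans zy)// ltW.
Qed.

(** * Charging cost at the optimal charging time *)

Section Charging.
Context {R : realType} {m : bottleneck R}.
Hypotheses (mass_gt0 : 0 < mass m) (capacity_gt0 : 0 < capacity m)
  (alpha_gt0 : 0 < alpha m) (beta_gt0 : 0 < beta m) (gamma_gt0 : 0 < gamma m)
  (beta_lt_alpha : beta m < alpha m) (dbar_gt0 : 0 < dbar m).

Local Notation mu := (@lebesgue_measure R).

(* At the optimal charging time a discount q costs the budget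
   [dbar * excess q] per vehicle, and saves the commuter [saving (excess q)]. *)
Definition excess (q : R) : R := Num.max (q - alpha m) 0.

Definition saving (w : R) : R := dbar m * (w ^+ 2 / (2 * (alpha m + w))).

Lemma excess_ge0 q : 0 <= excess q.
Proof. by rewrite le_max lexx orbT. Qed.

Lemma saving_ge0 w : 0 <= w -> 0 <= saving w.
Proof.
move=> w0; apply: mulr_ge0; first exact: ltW.
by rewrite divr_ge0 ?sqr_ge0// mulr_ge0// addr_ge0// ltW.
Qed.

(* The slope of [saving] is at most [dbar / 2]. *)
Lemma saving_increment w v c : 0 <= w -> 0 <= v -> 0 <= c ->
  saving v = saving w + c -> w + 2 * c / dbar m <= v.
Proof.
have a0 := alpha_gt0; move=> w0 v0 c0 E.
have aw : 0 < alpha m + w by lra.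
have av : 0 < alpha m + v by lra.
set e := 2 * c / dbar m.
have e0 : 0 <= e by rewrite divr_ge0 ?mulr_ge0// ltW.
(* As [v^2 / (alpha + v) = v - alpha + alpha^2 / (alpha + v)], the difference [saving v - saving w]
   equals [dbar / 2 * (v - w) * (1 - k)]. *)
set k := alpha m ^+ 2 / ((alpha m + w) * (alpha m + v)).
have {E} E : (v - w) * (1 - k) = e.
  rewrite /e /k; have -> : c = saving v - saving w by rewrite E; ring.
  by rewrite /saving; field; rewrite !gt_eqF.
have k0 : 0 < k by rewrite divr_gt0 ?mulr_gt0 ?exprn_gt0.
have [wv|vw] := leP w v; first by nra.
have k1 : k < 1 by rewrite ltr_pdivrMr ?mulr_gt0//; nra.
by nra.
Qed.

(** Above [alpha], multiplying [(1 - alpha / p) * dbar] by [p] gives [dbar * (p - alpha)]; up to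
    [alpha] both sides vanish. *)
Lemma delta_star_price (p : R -> R) t : 0 <= p t ->
  delta_star m p t * p t = dbar m * excess (p t).
Proof.
rewrite /delta_star /excess le0r; case: eqP => [-> _|_ /= p0].
  by rewrite mul0r max_r ?mulr0// sub0r oppr_le0 ltW.
rewrite maxr_pMl ?(ltW p0)// maxr_pMr ?(ltW dbar_gt0)// mul0r mulr0.
by congr Num.max; field; rewrite gt_eqF.
Qed.

Lemma charging_costE (p : R -> R) t delta : 0 <= delta ->
  charging_cost m p t delta = alpha m * delta + dbar m * pbar m
    - p t * (delta - delta ^+ 2 / (2 * dbar m)).
Proof.
move=> d0; rewrite /charging_cost /perceived_discount.
under eq_Rintegral do rewrite opprD addrA addrAC mulNr opprK [_ + _ * _]addrC.
rewrite Rintegral_affine; last by lra.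
by field; rewrite gt_eqF.
Qed.

(** For [p > alpha] the charging time is [dbar * (p - alpha) / p], and the cost falls by
    [dbar * (p - alpha)^2 / (2 * p)], which is [saving w] for [p = alpha + w]. *)
Lemma charging_cost_delta_star (p : R -> R) t : 0 <= p t ->
  charging_cost m p t (delta_star m p t)
    = dbar m * pbar m - saving (excess (p t)).
Proof.
have a0 := alpha_gt0; move=> p0; have dp := delta_star_price p0.
have d0 : 0 <= delta_star m p t.
  by rewrite /delta_star; case: ifP => // _; rewrite le_max lexx orbT.
rewrite charging_costE//.
have [pa|ap] := leP (p t) (alpha m).
  have e0 : excess (p t) = 0 by rewrite /excess max_r// subr_le0.
  suff -> : delta_star m p t = 0
    by rewrite e0 /saving expr0n /= !(mul0r, mulr0, subr0, oppr0, add0r).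
  (* Either factor of the zero product may vanish; a zero discount gives charging time 0 by
     definition. *)
  rewrite e0 mulr0 in dp; move/eqP: dp; rewrite mulf_eq0 => /orP[/eqP//|].
  by rewrite /delta_star => ->.
have eE : excess (p t) = p t - alpha m by rewrite /excess max_l// subr_ge0 ltW.
have pt : 0 < p t by lra.
have -> : delta_star m p t = dbar m * (p t - alpha m) / p t.
  by rewrite -eE -dp mulfK// gt_eqF.
by rewrite eE /saving; field; rewrite !gt_eqF//; lra.
Qed.

(** * Travel cost with and without a queue *)

Lemma travel_cost_empty Q t : Q t = 0 -> travel_cost m Q t = - g m t.
Proof.
have b0 := beta_gt0; have c0 := gamma_gt0.
move=> Q0; rewrite /travel_cost /earliness /waiting_time Q0 mul0r subr0 /g.
rewrite mulr0 add0r; case: ltP => tt; [rewrite max_l|rewrite max_r]; nra.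
Qed.

(** The two branches of the maximum bound the cost below: with waiting time [w] it is at least
    [- g + (alpha - beta) * w] before [tstar] and [- g + (alpha + gamma) * w] from [tstar] on.
    Equality with [- g] forces [w = 0]. *)
Lemma travel_cost_inj Q t : 0 <= Q t -> travel_cost m Q t = - g m t -> Q t = 0.
Proof.
have ba := beta_lt_alpha; have a0 := alpha_gt0; have c0 := gamma_gt0.
move=> Q0; rewrite /travel_cost; set d := earliness m Q t; set M := Num.max _ _.
have dE : d = tstar m - t - Q t / capacity m by [].
have w0 : 0 <= Q t / capacity m by rewrite divr_ge0// ltW.
have : beta m * d <= M by rewrite le_max lexx.
have : - gamma m * d <= M by rewrite le_max lexx orbT.
move: dE; rewrite /waiting_time; set w := Q t / _ in w0 *.
move=> -> Mg Mb E; suff w_eq0 : w = 0.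
  by rewrite -(divfK (lt0r_neq0 capacity_gt0) (Q t)) -/w w_eq0 mul0r.
by apply/le_anti; rewrite w0 andbT; move: E; rewrite /g; case: ltP => tt; nra.
Qed.

(** * Zero total travel time: queue, departure rate and budget *)

Lemma horizon_gt0 : 0 < horizon m.
Proof. exact: divr_gt0. Qed.

Lemma periodE t : period m t = (0 <= t <= horizon m) :> Prop.
Proof. by rewrite /period/= in_itv. Qed.

(** Outflow is at most [capacity], so a positive queue at [u] before the horizon persists for a
    while to the right of [u] and makes the integral positive. No continuity of [Q] is assumed. The
    horizon itself is treated separately. *)
Lemma empty_queue_of_total_travel_time r Q : departure_rate m r ->
  is_queue m r Q -> total_travel_time m Q = 0%E ->
  forall t, period m t -> Q t = 0.
Proof.
move=> [_ r0 _] [_ Q0 Qlast _ Qout] W0.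
have Qu u : 0 <= u < horizon m -> Q u = 0.
  move=> /andP[u0 uH]; apply/eqP; apply: contra_eqT W0 => Qu_neq0.
  have Qu_gt0 : 0 < Q u.
    by rewrite lt_neqAle eq_sym Qu_neq0 Q0// periodE u0 ltW.
  (* Up to [u + e] time stays within the period and at most half of the queue can leave. *)
  pose e := Num.min (horizon m - u) (Q u / (2 * capacity m)).
  have e0 : 0 < e.
    by rewrite lt_min subr_gt0 uH divr_gt0 ?mulr_gt0.
  have eH : u + e <= horizon m.
    by rewrite -lerBrDl ge_min lexx.
  pose c := Q u / 2 / capacity m.
  have c0 : 0 < c by rewrite !divr_gt0.
  pose f : R -> \bar R := (cst c%:E) \_ `[u, u + e].
  have f0 x : (0 <= f x)%E.
    by rewrite /f patchE; case: ifP => // _; rewrite lee_fin ltW.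
  have fQ x : period m x -> (f x <= (waiting_time m Q x)%:E)%E.
    rewrite periodE => /andP[x0 xH].
    rewrite /f patchE; case: ifPn => [|_]; last first.
      by rewrite lee_fin divr_ge0 ?(ltW capacity_gt0)// Q0// periodE x0.
    rewrite inE/= in_itv/= => /andP[ux xe].
    rewrite lee_fin ler_pM2r ?invr_gt0//.
    have : 0 <= \int[mu]_(tau in `[u, x]) r tau.
      apply: Rintegral_ge0 => z /=; rewrite in_itv/= => /andP[uz zx].
      by rewrite r0// periodE (le_trans u0 uz) (le_trans zx xH).
    have : capacity m * (x - u) <= Q u / 2.
      have : x - u <= Q u / (2 * capacity m).
        by apply: (@le_trans _ _ e); [rewrite lerBlDl|rewrite ge_min lexx orbT].
      rewrite -(ler_pM2l capacity_gt0) => /le_trans; apply.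
      by rewrite le_eqVlt; apply/orP; left; apply/eqP; field; rewrite gt_eqF.
    by have := Qout u x u0 ux xH; lra.
  rewrite gt_eqF//.
  apply: (lt_le_trans _ (ge0_integral_mono mu (fun x _ => f0 x) fQ)).
  rewrite -integral_mkcondr setIidr; last first.
    move=> x; rewrite periodE /= in_itv/= => /andP[ux xe].
    by rewrite (le_trans u0 ux) (le_trans xe eH).
  rewrite integral_cst; last exact: measurable_itv.
  rewrite [X in (_ * X)%E]lebesgue_measure_itv/= lte_fin ltrDl e0 -EFinB -EFinM lte_fin.
  by rewrite mulr_gt0// addrAC subrr add0r.
move=> t; rewrite periodE => /andP[t0].
rewrite le_eqVlt => /predU1P[tH|tH]; last by rewrite Qu ?t0.
(* At the horizon there is no room to the right; instead, a queue there has a last empty moment [v],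
   after which [Q] is nonzero, against its vanishing at the midpoint. *)
apply/eqP/negPn/negP => Qt_neq0.
have pt : period m t by rewrite periodE t0 tH lexx.
have Qt_gt0 : 0 < Q t by rewrite lt_neqAle eq_sym Qt_neq0 Q0.
have [v [/andP[v0 vt] _ Qv]] := Qlast t pt Qt_gt0.
apply: (Qv ((v + t) / 2)); first by rewrite !midf_lt.
by rewrite Qu// -tH midf_lt// andbT divr_ge0 ?addr_ge0 ?(ltW (le_lt_trans v0 vt)).
Qed.

(** Without a queue the rate is [capacity] almost everywhere, whatever the discount. *)
Lemma budget_empty_queue p r Q : discount_policy m p -> departure_rate m r ->
  is_queue m r Q -> (forall t, period m t -> Q t = 0) ->
  budget m p r =
    (\int[mu]_(t in period m) (capacity m * dbar m * excess (p t))%:E)%E.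
Proof.
move=> [mp p0] [mr r0 rE] [_ _ _ _ Qout] Q0.
have mper : measurable (period m) by exact: measurable_itv.
have ir : mu.-integrable (period m) (EFin \o r).
  apply/integrableP; split; first exact/measurable_EFinP.
  rewrite [ltLHS](_ : _ = (mass m)%:E) ?ltry// -rE; apply: eq_integral => x.
  by rewrite inE => /r0 rx; rewrite /= ger0_norm.
have prim x : 0 < x < horizon m ->
    \int[mu]_(y in `[0, x]) r y = capacity m * x.
  move=> /andP[x0 xH]; have H0 := horizon_gt0.
  have p0' : period m 0 by rewrite periodE lexx ltW.
  have px : period m x by rewrite periodE !ltW.
  have pH : period m (horizon m) by rewrite periodE lexx ltW.
  (* Inflow is at most [capacity] times the length on both [[0, x]] and [[x, horizon]]; the total
     mass attains the sum of these bounds, so both are equalities. *)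
  have := Qout 0 x (lexx _) (ltW x0) (ltW xH).
  have := Qout x (horizon m) (ltW x0) (ltW xH) (lexx _).
  rewrite !Q0// !subr0.
  rewrite -Rintegral_itv_obnd_cbnd; last first.
    apply: integrableS ir => // y; rewrite periodE /= in_itv/= => /andP[xy ->].
    by rewrite (ltW (lt_trans x0 xy)).
  rewrite -(@Rintegral_itvB _ r (BLeft 0)) ?bnd_simp ?(ltW x0) ?(ltW xH)//.
  have -> : \int[mu]_(t in `[0, horizon m]) r t = capacity m * horizon m.
    by rewrite /Rintegral rE /horizon mulrC divfK// gt_eqF.
  by lra.
have aer := ae_eq_cst_of_primitive ir prim.
have mex : measurable_fun (period m) (fun t => excess (p t)).
  by apply: measurable_maxr => //; exact: measurable_funB.
(* The rate is known only in the open interval, so the end points are removed. *)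
have E (f : R -> R) : measurable_fun (period m) f ->
    (\int[mu]_(t in period m) (f t)%:E =
     \int[mu]_(t in `]0%R, horizon m[) (f t)%:E)%E.
  move=> mf; rewrite integral_itv_bndoo//.
  apply/measurable_EFinP; apply: measurable_funS mf => //.
  exact: subset_itv_oo_cc.
have m1 : measurable_fun (period m) (fun t => r t * (dbar m * excess (p t))).
  by apply: measurable_funM => //; exact: measurable_funM.
have m2 : measurable_fun (period m) (fun t => capacity m * dbar m * excess (p t)).
  exact: measurable_funM.
transitivity (\int[mu]_(t in period m) (r t * (dbar m * excess (p t)))%:E)%E.
  apply: eq_integral => t; rewrite inE => /p0 pt.
  by rewrite -mulrA delta_star_price.
rewrite E// [RHS]E//; apply: ae_eq_integral => //.
- apply/measurable_EFinP; apply: measurable_funS m1 => //.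
  exact: subset_itv_oo_cc.
- apply/measurable_EFinP; apply: measurable_funS m2 => //.
  exact: subset_itv_oo_cc.
apply: filterS aer; first exact: (ae_filter_ringOfSetsType mu).
by move=> x rx /rx ->; rewrite mulrA.
Qed.

(** * The functions [g] and [pstar] *)

Lemma tstar_period : 0 < tstar m < horizon m.
Proof.
rewrite /tstar /horizon divr_gt0 ?mulr_gt0 ?addr_gt0//=.
rewrite ltr_pdivrMr ?mulr_gt0 ?addr_gt0//.
rewrite (_ : _ / _ * _ = (beta m + gamma m) * mass m); last by field; rewrite gt_eqF.
by rewrite ltr_pM2r// ltrDr.
Qed.

Lemma g_tstar : g m (tstar m) = 0.
Proof. by rewrite /g ltxx subrr mulr0. Qed.

Lemma g_lt0 t : t <> tstar m -> g m t < 0.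
Proof.
move/eqP; rewrite /g neq_lt => /orP[tt|tt].
  by rewrite tt pmulr_rlt0// subr_lt0.
by rewrite (lt_gtF tt) pmulr_rlt0// subr_lt0.
Qed.

Lemma g_le0 t : g m t <= 0.
Proof.
by have [->|/eqP/g_lt0/ltW//] := eqVneq t (tstar m); rewrite g_tstar.
Qed.

Lemma g_continuous : continuous (g m).
Proof.
have -> : g m = (fun t => beta m * (t - tstar m)) \min
                (fun t => gamma m * (tstar m - t)).
  apply/funext => t; rewrite /g /=; have b0 := beta_gt0; have c0 := gamma_gt0.
  by case: ltP => tt; [rewrite min_l|rewrite min_r]; nra.
move=> t; apply: continuous_min.
  by apply: cvgM; [exact: cvg_cst|apply: cvgB; [exact: cvg_id|exact: cvg_cst]].
by apply: cvgM; [exact: cvg_cst|apply: cvgB; [exact: cvg_cst|exact: cvg_id]].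
Qed.

Lemma pstar_continuous : continuous (pstar m).
Proof.
move=> t; have cg := g_continuous.
have cgd : {for t, continuous (fun t => g m t / dbar m)}.
  by apply: cvgM; [exact: cg|exact: cvg_cst].
have cd : {for t, continuous (fun t => g m t / dbar m - alpha m)}.
  by apply: cvgB; [exact: cgd|exact: cvg_cst].
have cr : {for t, continuous
    (fun t => (g m t / dbar m - alpha m) ^+ 2 - alpha m ^+ 2)}.
  apply: cvgB; last exact: cvg_cst.
  exact: continuous_comp cd (@exprn_continuous R 2 _).
apply: cvgD; first by apply: cvgB; [exact: cvg_cst|exact: cgd].
exact: continuous_comp cr (@sqrt_continuous R _).
Qed.

Lemma pstar_ge_alpha t : alpha m <= pstar m t.
Proof.
rewrite /pstar -addrA lerDl addr_ge0 ?sqrtr_ge0// oppr_ge0.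
by rewrite pmulr_lle0 ?invr_gt0// g_le0.
Qed.

Lemma excess_pstar t : excess (pstar m t) = pstar m t - alpha m.
Proof. by rewrite /excess max_l// subr_ge0 pstar_ge_alpha. Qed.

(** With [h = g / dbar], the equation [saving w = - g] reads [w^2 + 2 * h * w + 2 * h * alpha = 0],
    and [pstar - alpha] is its larger root. *)
Lemma saving_pstar t : saving (excess (pstar m t)) = - g m t.
Proof.
have a0 := alpha_gt0; have pa := pstar_ge_alpha t.
rewrite excess_pstar /saving; move: pa; rewrite /pstar.
set h := g m t / dbar m; set S := Num.sqrt _ => pa.
have h0 : h <= 0 by rewrite pmulr_lle0 ?invr_gt0// g_le0.
have S2 : S ^+ 2 = (h - alpha m) ^+ 2 - alpha m ^+ 2 by rewrite sqr_sqrtr//; nra.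
have -> : g m t = h * dbar m by rewrite divfK// gt_eqF.
have D0 : alpha m - h + S != 0 by rewrite gt_eqF//; lra.
have -> : (alpha m - h + S - alpha m) ^+ 2 = - h * (2 * (alpha m - h + S)).
  transitivity (h ^+ 2 - 2 * h * S + S ^+ 2); first by ring.
  by rewrite S2; ring.
by field; rewrite [X in X != 0](_ : _ = alpha m - h + S)//; ring.
Qed.

Lemma discount_policy_pstar : discount_policy m (pstar m).
Proof.
split=> [|t _]; last exact: le_trans (ltW alpha_gt0) (pstar_ge_alpha t).
by apply: measurable_funTS; exact: continuous_measurable_fun pstar_continuous.
Qed.

(** * Queue and saving at equilibrium *)

Lemma equilibrium_pstar_empty r Q : equilibrium m (pstar m) r Q ->
  forall t, period m t -> Q t = 0.
Proof.
move=> [_ [Q0 Qge0 _ _ _] [Ce CE]] t pt.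
have p0 : period m 0 by rewrite periodE lexx ltW ?horizon_gt0.
have pol := (discount_policy_pstar).2.
apply: travel_cost_inj; first exact: Qge0.
(* The queue is empty at time 0, which fixes the constant: the travel cost is [- g] throughout. *)
move: (CE t pt) (CE 0 p0); rewrite /total_cost !charging_cost_delta_star ?pol//.
by rewrite !saving_pstar (travel_cost_empty Q0); lra.
Qed.

Lemma equilibrium_empty_saving p r Q : discount_policy m p ->
  equilibrium m p r Q -> (forall t, period m t -> Q t = 0) ->
  exists2 c, 0 <= c &
    forall t, period m t -> saving (excess (p t)) = - g m t + c.
Proof.
move=> [_ p0] [_ _ [Ce CE]] Q0.
have E t : period m t ->
    saving (excess (p t)) = - g m t + (dbar m * pbar m - Ce).
  move=> pt; move: (CE t pt); rewrite /total_cost charging_cost_delta_star ?p0//.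
  by rewrite travel_cost_empty ?Q0//; lra.
exists (dbar m * pbar m - Ce) => //.
(* At [tstar] the function [g] vanishes, so the constant is itself a saving. *)
have pt : period m (tstar m).
  by rewrite periodE; have /andP[/ltW -> /ltW ->] := tstar_period.
by have := saving_ge0 (excess_ge0 (p (tstar m))); rewrite E// g_tstar oppr0 add0r.
Qed.

Lemma total_travel_time_empty Q : (forall t, period m t -> Q t = 0) ->
  total_travel_time m Q = 0%E.
Proof.
move=> Q0; apply: integral0_eq => t /Q0 Qt.
by rewrite /waiting_time Qt mul0r.
Qed.

Lemma total_travel_time_ge0 r Q : is_queue m r Q -> (0 <= total_travel_time m Q)%E.
Proof.
move=> [_ Q0 _ _ _]; apply: integral_ge0 => t pt.
by rewrite lee_fin divr_ge0 ?Q0// ltW.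
Qed.

Lemma equilibrium_pstar : equilibrium m (pstar m) (cst (capacity m)) (cst 0).
Proof.
have H0 := horizon_gt0; split.
- split=> [|t _|]; [exact: measurable_cst|exact: ltW|].
  transitivity ((capacity m)%:E * mu (period m))%E.
    have := integral_cst mu (measurable_itv `[0, horizon m]) (capacity m)%:E.
    exact.
  rewrite [X in (_ * X)%E]lebesgue_measure_itv/= lte_fin H0 -EFinB subr0 -EFinM.
  by rewrite /horizon mulrC divfK// gt_eqF.
- split=> //.
  + by move=> t _; rewrite ltxx.
  (* The zero queue has no last empty moment: it also vanishes at the midpoint of [v] and [t]. *)
  + move=> t v _ [/andP[_ vt] _ /(_ ((v + t) / 2))].
    by rewrite !midf_lt// => /(_ isT).
  + move=> u t u0 ut _; rewrite Rintegral_cst//.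
    rewrite [X in _ * fine X]lebesgue_measure_itv/= lte_fin.
    by case: ltgtP ut => //= [ut|->] _; rewrite ?subrr ?mulr0 ?subr0.
- exists (dbar m * pbar m) => t pt.
  have pol := (discount_policy_pstar).2.
  by rewrite /total_cost charging_cost_delta_star ?pol// saving_pstar
    travel_cost_empty//; ring.
Qed.

(** * The budget of [pstar] *)

Lemma pstar_integrable : mu.-integrable (period m) (EFin \o pstar m).
Proof.
apply: continuous_compact_integrable; first exact: segment_compact.
exact/continuous_subspaceT/pstar_continuous.
Qed.

Lemma g_integrable : mu.-integrable (period m) (EFin \o g m).
Proof.
apply: continuous_compact_integrable; first exact: segment_compact.
exact/continuous_subspaceT/g_continuous.
Qed.

(** Two triangles, with bases [tstar] and [horizon - tstar] and slopes [beta] and [- gamma]. *)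
Lemma Rintegral_g : \int[mu]_(t in period m) g m t =
  - (beta m * gamma m * mass m ^+ 2
      / (2 * capacity m ^+ 2 * (beta m + gamma m))).
Proof.
have /andP[t0 tH] := tstar_period.
have ig : mu.-integrable `[0, horizon m] (EFin \o g m) := g_integrable.
have /eqP := @Rintegral_itvB _ (g m) (BLeft 0) (BRight (horizon m)) (tstar m) ig
  (ltW t0) (ltW tH).
rewrite subr_eq => /eqP ->.
rewrite Rintegral_itv_obnd_cbnd; last first.
  apply: integrableS ig => // t /=; rewrite !in_itv/= => /andP[tt ->].
  by rewrite (ltW (lt_trans t0 tt)).
have -> : \int[mu]_(t in `[tstar m, horizon m]) g m t =
    \int[mu]_(t in `[tstar m, horizon m]) (- gamma m * t + gamma m * tstar m).
  apply: eq_Rintegral => t; rewrite inE/= in_itv/= => /andP[tt _].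
  by rewrite /g (le_gtF tt); ring.
have -> : \int[mu]_(t in `[0, tstar m]) g m t =
    \int[mu]_(t in `[0, tstar m]) (beta m * t + - (beta m * tstar m)).
  apply: eq_Rintegral => t; rewrite inE/= in_itv/= => /andP[_].
  rewrite le_eqVlt => /predU1P[->|tt]; first by rewrite g_tstar subrr.
  by rewrite /g tt; ring.
rewrite !Rintegral_affine ?(ltW t0) ?(ltW tH)//.
by rewrite /tstar /horizon; field; rewrite !gt_eqF ?addr_gt0.
Qed.

Lemma excess_pstar_integrable k :
  mu.-integrable (period m) (EFin \o (fun t => k * excess (pstar m t))).
Proof.
apply: continuous_compact_integrable; first exact: segment_compact.
have -> : (fun t => k * excess (pstar m t)) = (fun t => k * (pstar m t - alpha m)).
  by apply/funext => t; rewrite excess_pstar.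
apply: continuous_subspaceT => t.
apply: cvgM; first exact: cvg_cst.
by apply: cvgB; [exact: pstar_continuous|exact: cvg_cst].
Qed.

(** Pointwise, [p - alpha = (p - alpha)^2 / (2 * p) + (p^2 - alpha^2) / (2 * p)]; times [dbar], the
    first term is the saving [- g]. *)
Lemma integral_excess_pstar :
  (\int[mu]_(t in period m) (capacity m * dbar m * excess (pstar m t))%:E =
   (beta m * gamma m * mass m ^+ 2 / (2 * capacity m * (beta m + gamma m))
    + capacity m * dbar m * \int[mu]_(t in period m)
        ((pstar m t ^+ 2 - alpha m ^+ 2) / (2 * pstar m t)))%:E)%E.
Proof.
have mper : measurable (period m) by exact: measurable_itv.
have p0 t : 0 < pstar m t by exact: lt_le_trans alpha_gt0 (pstar_ge_alpha t).
have id : mu.-integrable (period m) (EFin \o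
    (fun t => (pstar m t ^+ 2 - alpha m ^+ 2) / (2 * pstar m t))).
  apply: continuous_compact_integrable; first exact: segment_compact.
  apply: continuous_subspaceT => t; have cp := @pstar_continuous t.
  apply: cvgM.
    apply: cvgB; last exact: cvg_cst.
    exact: (continuous_comp cp (@exprn_continuous R 2 _)).
  apply: cvgV; first by rewrite mulf_neq0// gt_eqF.
  by apply: cvgM; [exact: cvg_cst|exact: cp].
have ig := g_integrable.
rewrite -[LHS]fineK; last first.
  by apply: integrable_fin_num => //; exact: excess_pstar_integrable.
congr EFin.
transitivity (\int[mu]_(t in period m) (- capacity m * g m t + capacity m * dbar m *
    ((pstar m t ^+ 2 - alpha m ^+ 2) / (2 * pstar m t)))).
  apply: eq_Rintegral => t _.
  have -> : g m t = - saving (excess (pstar m t)) by rewrite saving_pstar opprK.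
  rewrite excess_pstar /saving; field.
  by rewrite gt_eqF ?p0.
have ikg := @integrableZl _ _ R mu _ mper (- capacity m) _ ig.
have ikd := @integrableZl _ _ R mu _ mper (capacity m * dbar m) _ id.
rewrite RintegralD ?RintegralZl//.
rewrite Rintegral_g; congr (_ + _).
by field; rewrite !gt_eqF ?addr_gt0.
Qed.

Lemma budget_equilibrium_pstar r Q : equilibrium m (pstar m) r Q ->
  budget m (pstar m) r =
    (\int[mu]_(t in period m) (capacity m * dbar m * excess (pstar m t))%:E)%E.
Proof.
move=> eq_rQ; have [dr qQ _] := eq_rQ.
exact: budget_empty_queue discount_policy_pstar dr qQ
  (equilibrium_pstar_empty eq_rQ).
Qed.

(** * Comparison of budgets, optimality and uniqueness *)

Lemma budget_ge_pstar p r Q c : discount_policy m p -> equilibrium m p r Q ->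
  (forall t, period m t -> Q t = 0) -> 0 <= c ->
  (forall t, period m t -> saving (excess (p t)) = - g m t + c) ->
  (\int[mu]_(t in period m) (capacity m * dbar m * excess (pstar m t))%:E
    + (2 * capacity m * c * horizon m)%:E <= budget m p r)%E.
Proof.
move=> pp [dr qQ _] Q0 c0 savE; have H0 := horizon_gt0.
have mper : measurable (period m) by exact: measurable_itv.
have muper : mu (period m) = (horizon m)%:E.
  by rewrite [LHS]lebesgue_measure_itv/= lte_fin H0 -EFinB subr0.
rewrite (budget_empty_queue pp dr qQ Q0).
have k0 : 0 < capacity m * dbar m by rewrite mulr_gt0.
have -> : (2 * capacity m * c * horizon m)%:E =
    (\int[mu]_(t in period m) (2 * capacity m * c)%:E)%E.
  transitivity ((2 * capacity m * c)%:E * mu (period m))%E; first by rewrite muper.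
  by apply/esym; exact: (@integral_cst _ _ R mu _ mper).
rewrite -integralD_EFin//=; last 2 first.
- exact: excess_pstar_integrable.
- apply: continuous_compact_integrable; first exact: segment_compact.
  by apply: continuous_subspaceT => t; exact: cvg_cst.
apply: ge0_integral_mono => t pt; rewrite lee_fin.
  by rewrite addr_ge0// ?mulr_ge0 ?excess_ge0 ?(ltW capacity_gt0) ?(ltW dbar_gt0).
have -> : capacity m * dbar m * excess (pstar m t) + 2 * capacity m * c =
    capacity m * dbar m * (excess (pstar m t) + 2 * c / dbar m).
  by field; rewrite gt_eqF.
rewrite ler_pM2l//; apply: saving_increment; rewrite ?excess_ge0//.
by rewrite savE// saving_pstar.
Qed.

Lemma optimal_pstar : optimal m (pstar m).
Proof.
split; first exact: discount_policy_pstar.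
  by exists (cst (capacity m)), (cst 0); exact: equilibrium_pstar.
move=> r Q eqQ p' r' Q' pp' eqQ'.
have [dr' qQ' _] := eqQ'.
rewrite (total_travel_time_empty (equilibrium_pstar_empty eqQ)).
split; first exact: total_travel_time_ge0 qQ'.
move=> /(empty_queue_of_total_travel_time dr' qQ') Q'0.
have [c c0 savE] := equilibrium_empty_saving pp' eqQ' Q'0.
rewrite (budget_equilibrium_pstar eqQ).
apply: le_trans (budget_ge_pstar pp' eqQ' Q'0 c0 savE).
apply: leeDl; rewrite lee_fin mulr_ge0 ?(ltW horizon_gt0)//.
by rewrite !mulr_ge0 ?(ltW capacity_gt0).
Qed.

(** The point [tstar] is excluded because zero saving there only says that the discount is at most
    [alpha]. *)
Lemma optimal_unique p : optimal m p ->
  forall t, period m t -> t <> tstar m -> p t = pstar m t.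
Proof.
move=> [pp [r [Q eqQ]] opt] t pt tt.
have eqS := equilibrium_pstar.
have [dr qQ _] := eqQ.
have S0 : total_travel_time m (cst 0) = 0%E by exact: total_travel_time_empty.
have [leW leB] := opt r Q eqQ _ _ _ discount_policy_pstar eqS.
have W0 : total_travel_time m Q = 0%E.
  by apply/le_anti; rewrite (total_travel_time_ge0 qQ) andbT -S0.
have Q0 := empty_queue_of_total_travel_time dr qQ W0.
have [c c0 savE] := equilibrium_empty_saving pp eqQ Q0.
have : 2 * capacity m * c * horizon m <= 0.
  have := le_trans (budget_ge_pstar pp eqQ Q0 c0 savE) (leB (etrans S0 (esym W0))).
  (* The budget of [pstar] is a real number, so it cancels. *)
  rewrite (budget_equilibrium_pstar eqS) integral_excess_pstar -EFinD !lee_fin.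
  by rewrite gerDl.
rewrite pmulr_lle0 ?horizon_gt0// pmulr_rle0 ?mulr_gt0// => c_le0.
have {c0 c_le0} c_eq0 : c = 0 by apply/le_anti; rewrite c_le0 c0.
have E : saving (excess (p t)) = saving (excess (pstar m t)).
  by rewrite savE// c_eq0 addr0 saving_pstar.
(* With increment 0 in both directions, [saving_increment] shows that [saving] is injective. *)
have ex : excess (p t) = excess (pstar m t).
  have := saving_increment (excess_ge0 (p t)) (excess_ge0 (pstar m t)) (lexx 0).
  have := saving_increment (excess_ge0 (pstar m t)) (excess_ge0 (p t)) (lexx 0).
  rewrite !addr0 mulr0 mul0r !addr0 => /(_ E) le1 /(_ (esym E)) le2.
  by apply/le_anti; rewrite le1 le2.
(* [excess] determines the discount only where it is positive. *)
have ex0 : 0 < excess (p t).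
  rewrite lt_neqAle excess_ge0 andbT ex; apply/eqP => e0.
  have := saving_pstar t; rewrite -e0 /saving expr0n/= mul0r mulr0 => /esym/eqP.
  by rewrite oppr_eq0 lt_eqF// g_lt0.
have pa : alpha m < p t.
  by move: ex0; rewrite /excess lt_max ltxx orbF subr_gt0.
move: ex; rewrite excess_pstar {1}/excess max_l ?subr_ge0 1?ltW//.
exact: addIr.
Qed.

End Charging.

Theorem proposition1 (R : realType) (m : bottleneck R)
    (mass_gt0 : 0 < mass m) (capacity_gt0 : 0 < capacity m)
    (alpha_gt0 : 0 < alpha m) (beta_gt0 : 0 < beta m) (gamma_gt0 : 0 < gamma m)
    (beta_lt_alpha : beta m < alpha m) (alpha_lt_gamma : alpha m < gamma m)
    (dbar_gt0 : 0 < dbar m) :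
  [/\ optimal m (pstar m),
      forall p : R -> R, optimal m p ->
        forall t, period m t -> t <> tstar m -> p t = pstar m t &
      forall r Q : R -> R, equilibrium m (pstar m) r Q ->
        total_travel_time m Q = 0%E /\
        budget m (pstar m) r =
          (beta m * gamma m * mass m ^+ 2
             / (2 * capacity m * (beta m + gamma m))
           + capacity m * dbar m *
             \int[@lebesgue_measure R]_(tau in `[0, mass m / capacity m])
               ((pstar m tau ^+ 2 - alpha m ^+ 2) / (2 * pstar m tau)))%:E].
Proof.
split=> [||r Q eqQ].
- exact: optimal_pstar.
- exact: optimal_unique.
- split; last first.
    rewrite (budget_equilibrium_pstar _ _ _ _ _ _ _ eqQ)//.
    exact: integral_excess_pstar.
  by apply: total_travel_time_empty; apply: equilibrium_pstar_empty eqQ.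
Qed.
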